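(* For instances of the online conversion problem with switching costs (OCS) of sequence length $T$, any online algorithm with advice that achieves 1-consistency (i.e., attains the offline optimal objective on every instance when its advice is correct) must use at least $\Omega(T)$ bits of advice.
   Context: OCS-min: known horizon $T$, rate constraints $d_t\in(0,1]$, constants $0<L<U$, switching cost coefficient $\beta>0$; an instance is a sequence of convex cost functions $g_t:[0,1]\to\mathbb{R}_{\ge0}$, $g_t(0)=0$, $L\le g_t'\le U$, revealed online; the player chooses irrevocably $x_t\in[0,d_t]$ with $\sum_t x_t=1$, and with $x_0=x_{T+1}=0$ pays $\sum_t g_t(x_t)+\beta\sum_{t=1}^{T+1}|x_t-x_{t-1}|$. OCS-max is analogous with concave price functions and objective $\sum_t g_t(x_t)-\beta\sum_t|x_t-x_{t-1}|$ to be maximized. In the advice model, an oracle that knows the whole instance supplies the online algorithm with a string of advice bits; the algorithm's decisions may depend on the advice and on the inputs revealed so far. *)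

(* Defs.v *)
From HB Require Import structures.
From mathcomp Require Export all_boot all_order all_algebra.
From mathcomp Require Export all_classical all_reals all_analysis.
Export numFieldNormedType.Exports.

Set Implicit Arguments.
Unset Strict Implicit.
Unset Printing Implicit Defensive.

Import Order.TTheory GRing.Theory Num.Theory.
Local Open Scope classical_set_scope.
Local Open Scope ring_scope.

Inductive ocs_kind := OCS_min | OCS_max.

(* Only the values of [g] on [0, 1] matter.  For a convex or concave function
   that is continuous at the endpoints, the bounds on the derivative in the open
   interval imply that the one-sided derivatives at 0 and 1 exist and obey the
   same bounds, so this is [L <= g' <= U] on all of [0, 1]. *)
Definition admissible_fun (R : realType) (k : ocs_kind) (L U : R)
    (g : R -> R) : Prop :=
  [/\ match k with
      | OCS_min => convex_function (E := R^o) `[0, 1] g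
      | OCS_max => convex_function (E := R^o) `[0, 1] (fun x => - g x)
      end,
      (forall x, x \in `[0, 1] -> 0 <= g x),
      g 0 = 0,
      derivable_oo_LRcontinuous g 0 1
    & forall x, x \in `]0, 1[ -> L <= derive1 g x <= U].

(* Times 1, ..., T are represented by the ordinals 0, ..., T.-1. *)
Record instance (R : realType) (T : nat) := Instance {
  rate : 'I_T -> R;
  fn : 'I_T -> R -> R
}.

(* [1 <= \sum_t rate I t] says that some decision sequence is feasible. *)
Definition valid_instance (R : realType) (T : nat) (k : ocs_kind) (L U : R)
    (I : instance R T) : Prop :=
  [/\ forall t, 0 < rate I t <= 1,
      1 <= \sum_t rate I t
    & forall t, admissible_fun k L U (fn I t)].

Definition feasible (R : realType) (T : nat) (I : instance R T)
    (x : 'I_T -> R) : Prop :=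
  (forall t, 0 <= x t <= rate I t) /\ \sum_t x t = 1.

(* The sequence x_0 = 0, x_1, ..., x_T, x_(T+1) = 0. *)
Definition padded (R : realType) (T : nat) (x : 'I_T -> R) (n : nat) : R :=
  if n is m.+1 then oapp x 0 (insub m) else 0.

Definition switching (R : realType) (T : nat) (x : 'I_T -> R) : R :=
  \sum_(1 <= t < T.+2) `|padded x t - padded x t.-1|.

Definition objective (R : realType) (T : nat) (k : ocs_kind) (beta : R)
    (I : instance R T) (x : 'I_T -> R) : R :=
  match k with
  | OCS_min => \sum_t fn I t (x t) + beta * switching x
  | OCS_max => \sum_t fn I t (x t) - beta * switching x
  end.

Definition offline_optimal (R : realType) (T : nat) (k : ocs_kind) (beta : R)
    (I : instance R T) (x : 'I_T -> R) : Prop :=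
  feasible I x /\
  forall y, feasible I y ->
    match k with
    | OCS_min => objective k beta I x <= objective k beta I y
    | OCS_max => objective k beta I y <= objective k beta I x
    end.

(* The oracle sees the whole instance.  The decision at time t is a function of
   the rate constraints (known in advance, as are the horizon and the constants),
   of the advice string, and of the functions revealed up to and including
   time t. *)
Record advice_algorithm (R : realType) (T : nat) := AdviceAlgorithm {
  oracle : instance R T -> seq bool;
  decide : ('I_T -> R) -> seq bool -> seq (R -> R) -> R
}.

Definition run (R : realType) (T : nat) (A : advice_algorithm R T)
    (advice : seq bool) (I : instance R T) (t : 'I_T) : R :=
  decide A (rate I) advice (take t.+1 [seq fn I i | i : 'I_T]).

Definition one_consistent (R : realType) (T : nat) (k : ocs_kind)
    (L U beta : R) (A : advice_algorithm R T) : Prop :=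
  forall I : instance R T, valid_instance k L U I ->
    offline_optimal k beta I (run A (oracle A I) I).

(* Main.v *)
(* The rates alternate between a peak value a and a valley value b < a, and
   b is repeated after the last of the 2n peaks (n = T / 4).  The slack in the
   rate constraints is n (a - b).  Lowering a peak to b saves the switching cost
   2 beta (a - b) whichever peak it is, so the optimum lowers the n peaks of
   largest cost slope (linear costs; prices are negative costs).  The slope of
   the i-th peak, i < n, is the midpoint of a binary search steered by bits
   s_0, ..., s_(i-1), so whether it lies above the final threshold, i.e. whether
   the peak is lowered, is the bit s_i, on which nothing revealed so far depends;
   the other n peaks have extreme slopes and complete the number of lowered peaks
   to n.  The optimal decisions at the first n peaks are forced, by linear
   programming duality with a subgradient of the switching cost.  Hence the 2^n
   strings s need pairwise distinct advice, some of it of length at least n. *)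
Require Import Defs.
From mathcomp Require Import zify ring lra.
Import Order.TTheory GRing.Theory Num.Theory.
Local Open Scope classical_set_scope.
Local Open Scope ring_scope.

Set Implicit Arguments.
Unset Strict Implicit.
Unset Printing Implicit Defensive.

(** * Linear functions and lengths of injective codes *)

Lemma admissible_linear (R : realType) (k : ocs_kind) (L U c : R) :
  0 <= L -> L <= c <= U -> admissible_fun k L U (fun x => c * x).
Proof.
move=> L_ge0 /andP[Lc cU]; have c_ge0 : 0 <= c by exact: le_trans Lc.
split.
- have convE (t : {i01 R}) (x y : convex_lmodType R^o) :
      conv t x y = t%:num * x + (1 - t%:num) * y :> R by [].
  by case: k => t x y _ _; rewrite le_eqVlt; apply/orP; left; apply/eqP;
    rewrite !convRE convE /unstable.onem; ring.
- by move=> x; rewrite in_itv /= => /andP[x_ge0 _]; rewrite mulr_ge0.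
- by rewrite mulr0.
- have ctn : continuous (fun x : R => c * x) by exact: mulrl_continuous.
  split; first by move=> x _; exact: derivableM.
    by apply: cvg_at_right_filter; exact: ctn.
  by apply: cvg_at_left_filter; exact: ctn.
- move=> x _; rewrite derive1E deriveM //= derive_cst derive_id scaler0 addr0.
  by rewrite /GRing.scale /= mulr1 Lc cU.
Qed.

(** Padding codes shorter than [n] to length exactly [n] would give an injective, hence surjective,
    self-map of the [n]-bit strings that misses the all-[false] string. *)
Lemma long_code (n : nat) (f : n.-tuple bool -> seq bool) :
  injective f -> exists s, (n <= size (f s))%N.
Proof.
move=> f_inj; apply/not_existsP => short.
have {}short s : (size (f s) < n)%N by rewrite ltnNge; apply/negP; exact: short.
(* The first [true] marks where the code begins, so the padding can be undone. *)
pose g s := nseq (n - (size (f s)).+1) false ++ true :: f s.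
have size_g s : size (g s) == n.
  by rewrite size_cat size_nseq /= subnK.
have index_g s : index true (g s) = (n - (size (f s)).+1)%N.
  by rewrite index_cat mem_nseq andbF size_nseq /= addn0.
have gK s : drop (index true (g s)).+1 (g s) = f s.
  by rewrite index_g /g -cat1s catA drop_size_cat // size_cat size_nseq addn1.
have G_inj : injective (fun s => Tuple (size_g s)).
  by move=> s1 s2 /(congr1 val) /= eq_g; apply: f_inj; rewrite -!gK eq_g.
have /codomP[s /(congr1 val) /= eq_g] := injF_onto G_inj [tuple of nseq n false].
have : true \in nseq n false by rewrite eq_g mem_cat inE eqxx orbT.
by rewrite mem_nseq andbF.
Qed.

(** * Linear programming duality with a switching cost *)

Section Duality.
Variables (R : realType) (T : nat) (beta theta : R).
Variables (d kappa : 'I_T -> R) (sigma : nat -> R).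
Hypothesis beta_gt0 : 0 < beta.
Hypothesis sigma_le1 : forall t, `|sigma t| <= 1.

Definition jump (x : 'I_T -> R) (t : nat) : R := padded x t.+1 - padded x t.

Definition cost (x : 'I_T -> R) : R :=
  \sum_t kappa t * x t + beta * switching x.

(** The Lagrangian coefficient of [x t]: [theta] is the multiplier of [\sum_t x t = 1], and [sigma]
    linearizes the switching cost from below. *)
Definition reduced_cost (t : 'I_T) : R :=
  kappa t + beta * (sigma t - sigma t.+1) - theta.

Lemma padded_ord (x : 'I_T -> R) (t : 'I_T) : padded x t.+1 = x t.
Proof. by rewrite /= valK. Qed.

Lemma padded_out (x : 'I_T -> R) (t : nat) : (T <= t)%N -> padded x t.+1 = 0.
Proof. by move=> Tt; rewrite /= insubF // ltnNge Tt. Qed.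

Lemma switchingE (x : 'I_T -> R) :
  switching x = \sum_(0 <= t < T.+1) `|jump x t|.
Proof. by rewrite /switching big_add1. Qed.

(** Abel summation; the boundary terms vanish because the padded sequence is 0 at both ends. *)
Lemma sum_sigma_jump (x : 'I_T -> R) :
  \sum_(0 <= t < T.+1) sigma t * jump x t =
  \sum_(t < T) (sigma t - sigma t.+1) * x t.
Proof.
have abel (p : nat -> R) m : p 0 = 0 ->
    \sum_(0 <= t < m.+1) sigma t * (p t.+1 - p t) =
    sigma m * p m.+1 + \sum_(0 <= t < m) (sigma t - sigma t.+1) * p t.+1.
  move=> p0; elim: m => [|m IHm].
    by rewrite big_nat1 big_nil p0 subr0 addr0.
  by rewrite big_nat_recr //= IHm big_nat_recr //=; ring.
rewrite abel // padded_out // mulr0 add0r big_mkord.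
by apply: eq_bigr => t _; rewrite padded_ord.
Qed.

Lemma jump_excess_ge0 (x : 'I_T -> R) t : 0 <= `|jump x t| - sigma t * jump x t.
Proof.
rewrite subr_ge0; apply: le_trans (ler_norm _) _.
by rewrite normrM ler_piMl.
Qed.

Lemma costE (x : 'I_T -> R) : \sum_t x t = 1 ->
  cost x = theta + \sum_t reduced_cost t * x t +
           beta * \sum_(0 <= t < T.+1) (`|jump x t| - sigma t * jump x t).
Proof.
move=> sum_x; rewrite sumrB -switchingE sum_sigma_jump mulrBr /cost.
have -> : \sum_t kappa t * x t =
    theta * \sum_t x t + \sum_t reduced_cost t * x t
    - beta * \sum_(t < T) (sigma t - sigma t.+1) * x t.
  rewrite !mulr_sumr -big_split -sumrB /=; apply: eq_bigr => t _.
  by rewrite /reduced_cost; ring.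
by rewrite sum_x; ring.
Qed.

Variable xs : 'I_T -> R.
Hypothesis sum_xs : \sum_t xs t = 1.
Hypothesis reduced_cost_le0 : forall t, reduced_cost t <= 0.
Hypothesis xs_saturated : forall t, reduced_cost t < 0 -> xs t = d t.
Hypothesis xs_aligned :
  forall t, (t <= T)%N -> `|jump xs t| = sigma t * jump xs t.

Lemma cost_gap (x : 'I_T -> R) : \sum_t x t = 1 ->
  cost x - cost xs = \sum_t reduced_cost t * (x t - xs t) +
    beta * \sum_(0 <= t < T.+1) (`|jump x t| - sigma t * jump x t).
Proof.
move=> sum_x; rewrite !costE //.
have -> : \sum_(0 <= t < T.+1) (`|jump xs t| - sigma t * jump xs t) = 0.
  by rewrite big_nat big1 // => t /andP[_ tT]; rewrite xs_aligned ?subrr.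
have -> : \sum_t reduced_cost t * (x t - xs t) =
    \sum_t reduced_cost t * x t - \sum_t reduced_cost t * xs t.
  by rewrite -sumrB; apply: eq_bigr => t _; rewrite mulrBr.
ring.
Qed.

Lemma reduced_cost_gap_ge0 (x : 'I_T -> R) t : x t <= d t ->
  0 <= reduced_cost t * (x t - xs t).
Proof.
move=> xd; have := reduced_cost_le0 t; rewrite le_eqVlt => /predU1P[->|neg].
  by rewrite mul0r.
by rewrite mulr_le0 ?(ltW neg) // xs_saturated // subr_le0.
Qed.

(** Both sums in [cost_gap] have nonnegative terms, so for a competitor no costlier than [xs] every
    term vanishes. *)
Lemma complementary_slackness (x : 'I_T -> R) : \sum_t x t = 1 ->
  (forall t, x t <= d t) -> cost x <= cost xs ->
  (forall t, reduced_cost t < 0 -> x t = d t) /\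
  (forall t, (t <= T)%N -> `|jump x t| = sigma t * jump x t).
Proof.
move=> sum_x xd; rewrite -subr_le0 cost_gap // => gap_le0.
have A_ge0 : 0 <= \sum_t reduced_cost t * (x t - xs t).
  by apply: sumr_ge0 => t _; exact: reduced_cost_gap_ge0.
have B_ge0 : 0 <= \sum_(0 <= t < T.+1) (`|jump x t| - sigma t * jump x t).
  by apply: sumr_ge0 => t _; exact: jump_excess_ge0.
have bB_ge0 := mulr_ge0 (ltW beta_gt0) B_ge0.
have A_eq0 : \sum_t reduced_cost t * (x t - xs t) == 0.
  by rewrite eq_le A_ge0 andbT; lra.
have B_eq0 : \sum_(0 <= t < T.+1) (`|jump x t| - sigma t * jump x t) == 0.
  by rewrite -(mulrI_eq0 _ (lregP (lt0r_neq0 beta_gt0))) eq_le bB_ge0 andbT; lra.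
split=> [t neg|t tT].
  move: A_eq0; rewrite psumr_eq0; last by move=> i _; exact: reduced_cost_gap_ge0.
  move=> /allP/(_ t (mem_index_enum t)).
  by rewrite mulf_eq0 (lt_eqF neg) /= subr_eq0 xs_saturated // => /eqP.
move: B_eq0; rewrite psumr_eq0; last by move=> i _; exact: jump_excess_ge0.
move=> /allP/(_ t); rewrite mem_index_iota ltnS tT /= => /(_ isT).
by rewrite subr_eq0 => /eqP.
Qed.

End Duality.

(** * Binary search and the pattern of lowered peaks *)

(* Binary search: [level (take i s)] is the midpoint of the interval left after
   the first [i] bits, bit [true] meaning that the search continues below it. *)
Fixpoint level (R : realType) (s : seq bool) : R :=
  if s is b :: s' then (if b then level R s' else 1 + level R s') / 2 else 1 / 2.

Lemma level_bounds (R : realType) (s : seq bool) : 0 < level R s < 1.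
Proof. by elim: s => [|b s /andP[? ?]] /=; last case: b; lra. Qed.

(** A common leading bit acts by an increasing affine map; this reduces the claim to [i = 0], where
    [level_bounds] separates the two halves at 1/2. *)
Lemma level_take (R : realType) (s : seq bool) (i : nat) : (i < size s)%N ->
  if nth false s i then level R s < level R (take i s)
  else level R (take i s) < level R s.
Proof.
elim: s i => // b s IHs [_|i /IHs] /=.
  by have /andP[] := level_bounds R s; case: b; lra.
by case: (nth _ _ _); case: b; lra.
Qed.

(* Peak [i < size s] is to be lowered iff bit [i] of [s] is set; the complementary
   second half makes the number of lowered peaks independent of [s]. *)
Definition reduced (s : seq bool) (i : nat) : bool :=
  nth false (s ++ map negb s) i.

Definition slope_level (R : realType) (s : seq bool) (i : nat) : R :=
  if (i < size s)%N then level R (take i s) else (reduced s i)%:R.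

Lemma slope_level_bounds (R : realType) (s : seq bool) (i : nat) :
  0 <= slope_level R s i <= 1.
Proof.
rewrite /slope_level; case: ifP => _.
  by have /andP[? ?] := level_bounds R (take i s); lra.
by case: reduced; rewrite ?lexx ?ler01.
Qed.

Lemma slope_level_reduced (R : realType) (s : seq bool) (i : nat) :
  if reduced s i then level R s < slope_level R s i
  else slope_level R s i < level R s.
Proof.
rewrite /slope_level; case: ltnP => [i_lt|_].
  by rewrite /reduced nth_cat i_lt; exact: level_take.
by have /andP[? ?] := level_bounds R s; case: reduced.
Qed.

Lemma slope_level_take (R : realType) (s s' : seq bool) (i : nat) :
  (i < size s)%N -> (i < size s')%N -> take i s = take i s' ->
  slope_level R s i = slope_level R s' i.
Proof. by rewrite /slope_level => -> -> ->. Qed.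

(** Peak number [i] is at time [2 * i], and each peak is followed by a valley before time
    [4 * n]. *)
Definition peak (n t : nat) : bool := ~~ odd t && (t < 4 * n)%N.

Definition kept (s : seq bool) (t : nat) : bool :=
  peak (size s) t && ~~ reduced s t./2.

Lemma sum_kept (s : seq bool) (T : nat) : (4 * size s <= T)%N ->
  (\sum_(t < T) kept s t = size s)%N.
Proof.
move=> sT; rewrite -(big_mkord xpredT (kept s : nat -> nat)).
rewrite (big_cat_nat _ sT) //= [X in (_ + X)%N]big_nat [X in (_ + X)%N]big1 ?addn0.
  have pairs m : (m <= 2 * size s)%N -> (\sum_(0 <= t < m.*2) kept s t =
      \sum_(0 <= i < m) ~~ reduced s i)%N.
    elim: m => [|m IHm] m_le; first by rewrite !big_nil.
    rewrite doubleS !big_nat_recr //= IHm ?(ltnW m_le) //.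
    rewrite /kept /peak /= odd_double doubleK /= addn0.
    by have -> : (m.*2 < 4 * size s)%N by lia.
  rewrite (_ : (4 * size s = (2 * size s).*2)%N); last by lia.
  rewrite pairs //.
  have -> : (2 * size s = size (s ++ map negb s))%N.
    by rewrite size_cat size_map; lia.
  rewrite -(big_nth false xpredT (fun b => ~~ b : nat)) big_cat big_map /=.
  (* Each bit and its negation together contribute exactly 1. *)
  by rewrite -big_split /= -sum1_size; apply: eq_bigr => -[].
by move=> t /andP[sTt _]; rewrite /kept /peak ltnNge sTt andbF.
Qed.

(** * The hard instances and their forced decisions *)

Section HardInstance.
Variables (R : realType) (T : nat) (k : ocs_kind) (L U beta : R).
Hypotheses (L_gt0 : 0 < L) (L_lt_U : L < U) (beta_gt0 : 0 < beta).

(** The bound [U - L] keeps the slopes admissible; the bound [beta] keeps [hard_sign] within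
    [-1, 1]. *)
Definition slope_range : R := Num.min (U - L) beta.

(* For [OCS_max] the cost slope is minus the price slope. *)
Definition min_slope : R := match k with OCS_min => L | OCS_max => - U end.

Definition hard_slope (s : seq bool) (t : nat) : R :=
  min_slope +
  slope_range * (if peak (size s) t then slope_level R s t./2 else 0).

(* [T * valley + n * bump n = 1]: with every rate saturated except for [n] of the
   [2 * n] peaks, lowered to [valley], exactly one unit is converted. *)
Definition valley : R := (2 * T%:R)^-1.

Definition bump (n : nat) : R := (2 * n%:R)^-1.

Definition hard_rate (n : nat) (t : 'I_T) : R := valley + (peak n t)%:R * bump n.

Definition hard_instance (s : seq bool) : instance R T :=
  Instance (hard_rate (size s))
    (fun t x => match k with
                | OCS_min => hard_slope s t
                | OCS_max => - hard_slope s t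
                end * x).

Definition optimum (s : seq bool) (t : 'I_T) : R :=
  valley + (kept s t)%:R * bump (size s).

(** The value of [theta]: since [2 * beta] is the switching cost per unit of peak height, keeping a
    peak pays off iff its level is below [level R s]. *)
Definition threshold (s : seq bool) : R :=
  min_slope + slope_range * level R s + 2 * beta.

(* A subgradient of the switching cost at [optimum s].  After a reduced peak
   the jump vanishes, so any value in [-1, 1] is allowed; the one chosen gives
   that peak reduced cost zero. *)
Definition hard_sign (s : seq bool) (t : nat) : R :=
  if (t < 4 * size s)%N then
    if odd t then
      if reduced s t./2 then
        slope_range * (slope_level R s t./2 - level R s) / beta - 1
      else -1
    else 1
  else -1.

Lemma slope_range_gt0 : 0 < slope_range.
Proof. by rewrite lt_min subr_gt0 L_lt_U. Qed.

(** Strictness serves uniqueness: a jump aligned with a sign strictly inside [-1, 1] is zero. *)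
Lemma hard_sign_reduced (s : seq bool) (t : nat) :
  (t < 4 * size s)%N -> odd t -> reduced s t./2 -> -1 < hard_sign s t < 0.
Proof.
move=> t_lt t_odd t_red; rewrite /hard_sign t_lt t_odd t_red.
have := slope_level_reduced R s t./2; rewrite t_red => lt_level.
have /andP[_ le1] := slope_level_bounds R s t./2.
have /andP[gt0 _] := level_bounds R s.
have D_gt0 := slope_range_gt0.
have D_le : slope_range <= beta by rewrite ge_min lexx orbT.
have e_gt0 : 0 < slope_range * (slope_level R s t./2 - level R s) / beta.
  by rewrite divr_gt0 // mulr_gt0 // subr_gt0.
have e_lt1 : slope_range * (slope_level R s t./2 - level R s) / beta < 1.
  by rewrite ltr_pdivrMr // mul1r; nra.
by apply/andP; split; lra.
Qed.

Lemma hard_sign_le1 (s : seq bool) (t : nat) : `|hard_sign s t| <= 1.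
Proof.
have [/andP[t_lt /andP[t_odd t_red]]|] :=
    boolP [&& (t < 4 * size s)%N, odd t & reduced s t./2].
  by rewrite ler_norml; have /andP[? ?] := hard_sign_reduced t_lt t_odd t_red; lra.
rewrite /hard_sign; case: ifP => // _; last by rewrite normrN1.
by case: odd; case: reduced; rewrite //= ?normrN1 ?normr1.
Qed.

Section Optimum.
Variable s : seq bool.
Hypotheses (s_gt0 : (0 < size s)%N) (s_le : (4 * size s <= T)%N).

Local Notation n := (size s).

Lemma valley_gt0 : 0 < valley.
Proof. by rewrite invr_gt0 mulr_gt0 // ltr0n; lia. Qed.

Lemma bump_gt0 : 0 < bump n.
Proof. by rewrite invr_gt0 mulr_gt0 // ltr0n. Qed.

Lemma optimum_le_rate (t : 'I_T) : optimum s t <= hard_rate n t.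
Proof.
rewrite lerD2l ler_wpM2r ?(ltW bump_gt0) // ler_nat /kept.
by case: peak; case: reduced.
Qed.

Lemma sum_optimum : \sum_t optimum s t = 1.
Proof.
rewrite big_split /= sumr_const card_ord -mulr_suml -natr_sum sum_kept //.
rewrite -[valley *+ T]mulr_natl /valley /bump.
have T_neq0 : T%:R != 0 :> R by rewrite pnatr_eq0; lia.
have n_neq0 : n%:R != 0 :> R by rewrite pnatr_eq0; lia.
by field; rewrite T_neq0 n_neq0.
Qed.

Lemma optimum_feasible : feasible (hard_instance s) (optimum s).
Proof.
split=> [t|]; last exact: sum_optimum.
by rewrite optimum_le_rate andbT addr_ge0 ?(ltW valley_gt0) // mulr_ge0 //
  ltW // bump_gt0.
Qed.

Lemma hard_slope_bounds (t : nat) :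
  min_slope <= hard_slope s t <= min_slope + (U - L).
Proof.
have D_ge0 := ltW slope_range_gt0.
have D_le : slope_range <= U - L by rewrite ge_min lexx.
rewrite /hard_slope; case: peak; last by rewrite mulr0 addr0 lexx /=; lra.
by have /andP[? ?] := slope_level_bounds R s t./2; apply/andP; split; nra.
Qed.

Lemma hard_instance_valid : valid_instance k L U (hard_instance s).
Proof.
split=> [t||t].
- rewrite /= /hard_rate; apply/andP; split.
    by rewrite ltr_pwDl ?valley_gt0 // mulr_ge0 // ltW // bump_gt0.
  (* Both [valley] and [bump] are at most 1/2, so their sum is a legal rate. *)
  have half_inv m : (0 < m)%N -> (2 * m%:R)^-1 <= 1 / 2 :> R.
    move=> m_gt0; rewrite div1r lef_pV2 ?posrE ?mulr_gt0 ?ltr0n //.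
    by rewrite ler_pMr // ler1n.
  have := half_inv T (leq_ltn_trans (leq0n _) (ltn_ord t)).
  have := half_inv n s_gt0; rewrite -/valley -/(bump n).
  have := bump_gt0; case: peak; rewrite ?mul1r ?mul0r; lra.
- by rewrite -sum_optimum; apply: ler_sum => t _; exact: optimum_le_rate.
- have := hard_slope_bounds t; rewrite /= /min_slope; case: k => /andP[? ?];
    by apply: admissible_linear; [exact: ltW | apply/andP; split; lra].
Qed.

Let kappa (t : 'I_T) : R := hard_slope s t.

Lemma reduced_cost_peak (t : 'I_T) : peak n t -> reduced s t./2 ->
  reduced_cost beta (threshold s) kappa (hard_sign s) t = 0.
Proof.
move=> t_peak t_red; have /andP[t_even t_lt] := t_peak.
have -> : reduced_cost beta (threshold s) kappa (hard_sign s) t =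
    hard_slope s t + beta * (hard_sign s t - hard_sign s t.+1) - threshold s.
  by [].
rewrite /hard_slope t_peak /hard_sign t_lt (negbTE t_even) /=.
have -> : (t.+1 < 4 * n)%N by lia.
have -> : uphalf t = t./2 by lia.
rewrite t_even t_red /threshold.
by field; rewrite gt_eqF.
Qed.

(** At a kept peak the sign difference is at most 2, which [threshold] offsets, and the slope level
    is below [level R s]. Elsewhere the slope is minimal and the sign at [t] is nonpositive, so the
    difference is at most 1. *)
Lemma reduced_cost_lt0 (t : 'I_T) : ~~ (peak n t && reduced s t./2) ->
  reduced_cost beta (threshold s) kappa (hard_sign s) t < 0.
Proof.
have -> : reduced_cost beta (threshold s) kappa (hard_sign s) t =
    hard_slope s t + beta * (hard_sign s t - hard_sign s t.+1) - threshold s.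
  by [].
have /andP[level_gt0 _] := level_bounds R s; have D_gt0 := slope_range_gt0.
have Dlevel_gt0 := mulr_gt0 D_gt0 level_gt0.
rewrite /hard_slope /threshold.
have /andP[sign_ge sign_le] : -1 <= hard_sign s t.+1 <= 1.
  by rewrite -ler_norml hard_sign_le1.
have [t_peak /= t_red|t_npeak _] := boolP (peak n t).
  have := slope_level_reduced R s t./2; rewrite (negbTE t_red) => lt_level.
  have /andP[_ t_le1] : -1 <= hard_sign s t <= 1.
    by rewrite -ler_norml hard_sign_le1.
  rewrite -(ltr_pM2l D_gt0) in lt_level.
  have : beta * (hard_sign s t - hard_sign s t.+1) <= beta * 2.
    by rewrite ler_pM2l //; lra.
  by lra.
rewrite mulr0 addr0.
have : hard_sign s t <= 0.
  have [t_lt|t_ge] := ltnP t (4 * n)%N; last first.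
    by rewrite /hard_sign ltnNge t_ge /= lerN10.
  have t_odd : odd t by move: t_npeak; rewrite /peak t_lt andbT negbK.
  have [t_red|t_nred] := boolP (reduced s t./2).
    by have /andP[_ /ltW] := hard_sign_reduced t_lt t_odd t_red.
  by rewrite /hard_sign t_lt t_odd (negbTE t_nred) lerN10.
move=> sign_le0.
have : beta * (hard_sign s t - hard_sign s t.+1) <= beta * 1.
  by rewrite ler_pM2l //; lra.
by have b_gt0 := beta_gt0; lra.
Qed.

Lemma reduced_cost_le0 (t : 'I_T) :
  reduced_cost beta (threshold s) kappa (hard_sign s) t <= 0.
Proof.
have [/andP[? ?]|?] := boolP (peak n t && reduced s t./2).
  by rewrite reduced_cost_peak.
by rewrite ltW // reduced_cost_lt0.
Qed.

Lemma optimum_saturated (t : 'I_T) :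
  reduced_cost beta (threshold s) kappa (hard_sign s) t < 0 ->
  optimum s t = hard_rate n t.
Proof.
rewrite /optimum /hard_rate /kept.
case: (boolP (peak n t)) => //= t_peak; case: (boolP (reduced s t./2)) => //.
by move=> t_red; rewrite reduced_cost_peak // ltxx.
Qed.

Lemma padded_optimum (t : nat) : (t < T)%N ->
  padded (optimum s) t.+1 = valley + (kept s t)%:R * bump n.
Proof. by move=> tT; rewrite (padded_ord (optimum s) (Ordinal tT)). Qed.

Lemma optimum_aligned (t : nat) : (t <= T)%N ->
  `|jump (optimum s) t| = hard_sign s t * jump (optimum s) t.
Proof.
have opt_ge0 m : 0 <= padded (optimum s) m.
  case: m => //= m; case: insub => //= i.
  by have [/(_ i) /andP[]] := optimum_feasible.
have h_ge0 := ltW bump_gt0.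
have up j : 0 <= j -> `|j| = 1 * j by move=> /ger0_norm ->; rewrite mul1r.
have down j : j <= 0 -> `|j| = -1 * j by move=> /ler0_norm ->; rewrite mulN1r.
case: t => [_|t].
  rewrite /hard_sign muln_gt0 s_gt0 /=; apply: up.
  by rewrite /jump subr0.
rewrite leq_eqVlt => /predU1P[t_T|t_lt].
  rewrite /hard_sign t_T ltnNge s_le /=; apply: down.
  by rewrite /jump padded_out // sub0r oppr_le0.
have -> : jump (optimum s) t.+1 = ((kept s t.+1)%:R - (kept s t)%:R) * bump n.
  by rewrite /jump !padded_optimum ?(ltnW t_lt) //; ring.
rewrite /hard_sign.
have [t_lt4|t_ge4] := ltnP t.+1 (4 * n)%N; last first.
  rewrite /kept /peak (_ : (t.+1 < 4 * n)%N = false) ?andbF /=; last by lia.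
  (* Here [t < 4 * n] leaves only [t = 4 * n - 1], which is odd. *)
  rewrite (_ : ~~ odd t && (t < 4 * n)%N = false) /=; last by lia.
  by rewrite subrr mul0r normr0 mulr0.
case: ifPn => t_odd.
  have -> : kept s t.+1 = false by rewrite /kept /peak t_odd.
  have -> : t.+1./2 = t./2 by move: t_odd => /=; lia.
  case: ifPn => t_red.
    by rewrite /kept t_red andbF subrr mul0r normr0 mulr0.
  by apply: down; rewrite sub0r mulNr oppr_le0 mulr_ge0.
have {}t_odd : odd t by exact: negbNE t_odd.
have -> : kept s t = false by rewrite /kept /peak t_odd.
by apply: up; rewrite subr0 mulr_ge0.
Qed.

Lemma objective_cost (x : 'I_T -> R) :
  objective k beta (hard_instance s) x =
  match k with
  | OCS_min => cost beta kappa x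
  | OCS_max => - cost beta kappa x
  end.
Proof.
rewrite /objective /cost /=; case: k => //.
by rewrite opprD -sumrN; congr (_ - _); apply: eq_bigr => t _; rewrite mulNr.
Qed.

(** A kept peak has negative reduced cost, hence is saturated. A reduced peak is followed by a
    saturated valley, and the jump between them must vanish. *)
Lemma hard_instance_unique (x : 'I_T -> R) (t : 'I_T) :
  offline_optimal k beta (hard_instance s) x -> peak n t ->
  x t = valley + (~~ reduced s t./2)%:R * bump n.
Proof.
move=> [[x_bounds sum_x] /(_ _ optimum_feasible)]; rewrite !objective_cost.
move=> x_opt t_peak.
have {}x_opt : cost beta kappa x <= cost beta kappa (optimum s).
  by move: x_opt; case: k => //; rewrite lerN2.
have x_le i : x i <= hard_rate n i by case/andP: (x_bounds i).
have [sat align] := complementary_slackness beta_gt0 (hard_sign_le1 s)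
  sum_optimum reduced_cost_le0 optimum_saturated optimum_aligned sum_x x_le x_opt.
have [t_red|t_nred] := boolP (reduced s t./2); last first.
  by rewrite sat ?reduced_cost_lt0 ?negb_and ?t_nred ?orbT // /hard_rate t_peak.
have /andP[t_even t_lt] := t_peak.
have t1_lt : (t.+1 < 4 * n)%N by lia.
have t1_T : (t.+1 < T)%N by exact: leq_trans t1_lt s_le.
have t1_odd : odd t.+1 by [].
have t1_half : t.+1./2 = t./2 by move: t_even => /=; lia.
have t1_npeak : peak n t.+1 = false by rewrite /peak t1_odd.
have := align t.+1 (ltnW t1_T).
have /andP[] : -1 < hard_sign s t.+1 < 0.
  by apply: hard_sign_reduced; rewrite ?t1_half.
rewrite /jump padded_ord (padded_ord x (Ordinal t1_T)).
rewrite (sat (Ordinal t1_T)) ?reduced_cost_lt0 //= ?t1_npeak //.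
rewrite /hard_rate /= t1_npeak mul0r addr0 => sign_gt sign_lt.
set j := valley - x t => j_eq.
have j_le0 : j <= 0.
  by rewrite leNgt; apply/negP => j_gt0; have := normr_ge0 j; rewrite j_eq; nra.
have : j = 0 by move: j_eq; rewrite ler0_norm //; nra.
by rewrite /j; lra.
Qed.

End Optimum.

(** Up to time [t] only peaks [i <= t./2] are revealed, each with a slope steered by the first [i]
    bits, so bit [t./2] is still hidden. *)
Lemma hard_run_eq (A : advice_algorithm R T) (adv : seq bool) (s s' : seq bool)
    (t : 'I_T) :
  size s = size s' -> (t./2 < size s)%N -> take t./2 s = take t./2 s' ->
  run A adv (hard_instance s) t = run A adv (hard_instance s') t.
Proof.
move=> size_eq t_lt take_eq.
rewrite /run; congr (decide A _ _ _); first by rewrite /= size_eq.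
have take_fn (I : instance R T) : take t.+1 [seq fn I i | i : 'I_T] =
    [seq fn I i | i <- take t.+1 (enum 'I_T)] by rewrite map_take.
rewrite !take_fn; apply/eq_in_map => i.
have t_le : (t.+1 <= size (enum 'I_T))%N by rewrite size_enum_ord.
move=> i_take; have i_le : (i <= t)%N.
  by rewrite -ltnS -{1}(index_enum_ord i) -(in_take_leq i t_le).
apply/funext => x; rewrite /=.
have -> // : hard_slope s i = hard_slope s' i.
rewrite /hard_slope -size_eq; case: ifP => // _.
have i_half : (i./2 <= t./2)%N by exact: half_leq.
rewrite (@slope_level_take R s s') // -?size_eq ?(leq_ltn_trans i_half) //.
by rewrite -(take_takel s i_half) take_eq take_takel.
Qed.

End HardInstance.

Theorem theorem4 (R : realType) (k : ocs_kind) (L U beta : R)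
    (L_gt0 : 0 < L) (L_lt_U : L < U) (beta_gt0 : 0 < beta) :
  exists2 c : R, 0 < c &
    exists T0 : nat, forall T : nat, (T0 <= T)%N ->
      forall A : advice_algorithm R T, one_consistent k L U beta A ->
        exists2 I : instance R T, valid_instance k L U I &
          c * T%:R <= (size (oracle A I))%:R.
Proof.
(* For [T >= 4], [n = T %/ 4] satisfies [T <= 8 * n]. *)
exists (1 / 8) => //; exists 4 => T T_ge4 A A_consistent.
pose n := (T %/ 4)%N.
have n_gt0 : (0 < n)%N by rewrite /n; lia.
have n_le : (4 * n <= T)%N by rewrite /n; lia.
pose I (s : n.-tuple bool) := hard_instance T k L U beta s.
have I_valid s : valid_instance k L U (I s).
  by apply: hard_instance_valid; rewrite ?size_tuple.
have oracle_inj : injective (fun s => oracle A (I s)).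
  move=> s s' /= adv_eq; apply/val_inj => /=.
  (* Induction on the common prefix: equal advice and equal first [i] bits give equal decisions at
     peak [i], which reveal bit [i]. *)
  suff take_eq i : (i <= n)%N -> take i s = take i s'.
    by rewrite -(take_size s) -(take_size s') !size_tuple take_eq.
  elim: i => [|i IHi] i_lt; first by rewrite !take0.
  rewrite !(take_nth false) ?size_tuple // IHi ?(ltnW i_lt) //; congr rcons.
  have t_lt : (i.*2 < T)%N by lia.
  pose t : 'I_T := Ordinal t_lt.
  have peak_t : peak n t by rewrite /peak /= odd_double /=; lia.
  have decision (u : n.-tuple bool) : run A (oracle A (I u)) (I u) t =
      valley R T + (~~ nth false u i)%:R * bump R n.
    rewrite (hard_instance_unique L_gt0 L_lt_U beta_gt0 _ _
      (A_consistent _ (I_valid u))) ?size_tuple //.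
    by rewrite /reduced /= doubleK nth_cat size_tuple i_lt.
  have : run A (oracle A (I s)) (I s) t = run A (oracle A (I s')) (I s') t.
    rewrite adv_eq; apply: hard_run_eq; rewrite /= ?doubleK ?size_tuple //.
    exact/IHi/ltnW.
  rewrite !decision => /addrI.
  have bump_n : 0 < bump R n by rewrite invr_gt0 mulr_gt0 // ltr0n.
  move=> /(mulIf (lt0r_neq0 bump_n)) /eqP; rewrite eqr_nat.
  by case: nth; case: nth.
have [s s_long] := long_code oracle_inj.
exists (I s) => //.
have : (T <= 8 * size (oracle A (I s)))%N by rewrite /n in s_long; lia.
by rewrite -(ler_nat R) natrM; lra.
Qed.
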